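(* Let $n\ge 3$ be an integer and let $\mathcal{T}$ be a nonempty finite set of $3$-element subsets of a totally ordered set. If $|\mathcal{T}|<\binom{n}{3}$, then $\lambda(\mathcal{T})\le n-1$. Furthermore, if $|\mathcal{T}|=\binom{n}{3}$ and $\lambda(\mathcal{T})>n-1$, then $\lambda(\mathcal{T})=n$, $\Gamma_0(\mathcal{T})$ is isomorphic to $K_n$, and $\mathcal{T}$ is precisely the set of all $3$-element subsets of $V(\Gamma_0(\mathcal{T}))$.
   Context: For a $3$-element subset $T=\{a,b,c\}$ of a totally ordered set with $a<b<c$ and a $2$-element subset $e$, the sign $[T:e]$ is $1$ if $e=\{a,b\}$ or $e=\{b,c\}$, $-1$ if $e=\{a,c\}$, and $0$ if $e\not\subset T$. The support graph $\Gamma_0(\mathcal{T})$ has vertex set $\bigcup_{T\in\mathcal T}T$, two distinct vertices being adjacent iff they lie in a common member of $\mathcal T$. $\delta_{1,\mathcal T}$ is the $\mathcal T\times E(\Gamma_0(\mathcal T))$ matrix with entries $[T:e]$, and $\lambda(\mathcal T)$ is the smallest positive eigenvalue of $\delta_{1,\mathcal T}^T\delta_{1,\mathcal T}$ (independent of the total order). *)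

(* Defs.v *)
From HB Require Import structures.
From mathcomp Require Import all_boot all_order all_algebra finmap.
From mathcomp Require Import polyrcf complex.
From mathcomp Require Import boolp classical_sets reals.

Set Implicit Arguments.
Unset Strict Implicit.
Unset Printing Implicit Defensive.

Import Order.TTheory GRing.Theory Num.Theory.

Local Open Scope ring_scope.
Local Open Scope fset_scope.

(* The sign [T : e]. Sorting t yields [:: a; b; c] with a < b < c when t has
   three elements; the value on sets t of any other size is irrelevant. *)
Definition incidence_sign (d : Order.disp_t) (V : orderType d)
    (t e : {fset V}) : int :=
  if sort <=%O (enum_fset t) is [:: a; b; c] then
    if (e == [fset a; b]) || (e == [fset b; c]) then 1
    else if e == [fset a; c] then -1
    else 0
  else 0.

Definition support_vertices (V : choiceType) (T : {fset {fset V}}) :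
    {fset V} :=
  \bigcup_(t <- T) t.

Definition support_adj (V : choiceType) (T : {fset {fset V}}) : rel V :=
  fun x y => (x != y) && has (fun t : {fset V} => (x \in t) && (y \in t)) T.

Definition support_edges (V : choiceType) (T : {fset {fset V}}) :
    {fset {fset V}} :=
  [fset [fset x; y] | x in support_vertices T, y in support_vertices T
                      & support_adj T x y].

Definition delta1 (R : realType) (d : Order.disp_t) (V : orderType d)
    (T : {fset {fset V}}) : 'M[R]_(#|{: T}|, #|{: support_edges T}|) :=
  \matrix_(i, j)
    (incidence_sign (fsval (enum_val i)) (fsval (enum_val j)))%:~R.

Definition is_smallest_pos_eigenvalue (R : realType) (m : nat) (M : 'M[R]_m)
    (l : R) : Prop :=
  [/\ eigenvalue M l, 0 < l
    & forall mu : R, eigenvalue M mu -> 0 < mu -> l <= mu].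

(* The default value 0 is never used when T is a nonempty family of 3-element
   sets: see lambdaP below. *)
Definition lambda (R : realType) (d : Order.disp_t) (V : orderType d)
    (T : {fset {fset V}}) : R :=
  xget 0 [set l : R |
    is_smallest_pos_eigenvalue ((delta1 R T)^T *m delta1 R T) l]%classic.

Definition graph_iso (U W : finType) (e : rel U) (f : rel W) : Prop :=
  exists2 h : U -> W, bijective h & forall x y, f (h x) (h y) = e x y.

Definition support_graph (V : choiceType) (T : {fset {fset V}}) :
    rel (support_vertices T) :=
  fun x y => support_adj T (fsval x) (fsval y).
Arguments support_graph {V} T x y.

Definition complete_graph (n : nat) : rel 'I_n := fun i j => i != j.
Arguments complete_graph n i j : clear implicits.

Lemma ex_smallest_pos_eigenvalue (R : realType) (p m : nat) (A : 'M[R]_(p, m)) :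
  A != 0 -> exists l, is_smallest_pos_eigenvalue (A^T *m A) l.
Proof.
move=> A0; set S := A^T *m A.
have [l l0 lE] : exists2 l, 0 < l & eigenvalue S l.
  pose toC q r := map_mx (real_complex R) : 'M_(q, r) -> 'M_(q, r).
  have conjR q r (B : 'M[R]_(q, r)) : map_mx Num.conj (toC q r B) = toC q r B.
    by apply/matrixP=> i j; rewrite !mxE; exact: conjc_real.
  have ST : S^T = S by rewrite /S trmx_mul trmxK.
  have /orthomx_spectralP : toC m m S \is normalmx.
    by apply/normalmxP; rewrite -map_trmx conjR map_trmx ST.
  set P := spectralmx _; set sp := spectral_diag _ => SE.
  have PU : P \in unitmx by exact: spectral_unit.
  have [sp0|/rV0Pn[i spi]] := eqVneq sp 0.
    case/eqP: A0; have: toC m m S = 0.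
      by rewrite SE sp0 (_ : diag_mx 0 = 0) ?mulmx0 ?mul0mx ?raddf0.
    move=> S0; apply/matrixP => i j; rewrite mxE.
    have /matrixP/(_ j j) : S = 0
      by apply: (map_mx_inj (f := real_complex R)); rewrite map_mx0.
    rewrite !mxE => /eqP; rewrite psumr_eq0 => [/allP/(_ i)|k _]; last first.
      by rewrite mxE -expr2 sqr_ge0.
    by rewrite mem_index_enum mxE mulf_eq0 orbb => /(_ isT)/eqP.
  pose v := row i P; have vE : v *m toC m m S = sp 0 i *: v.
    rewrite SE !mulmxA -!row_mul mulmxV // mul1mx row_mul row_diag_mx.
    by rewrite -scalemxAl -rowE.
  have vv : dotmx v v = 1.
    by have /row_unitarymxP/(_ i i) := spectral_unitarymx (toC m m S); rewrite eqxx.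
  have spE : sp 0 i = dotmx (v *m toC m p A^T) (v *m toC m p A^T).
    rewrite dotmxE trmx_mul map_mxM map_trmx trmxK conjR.
    rewrite mulmxA -(mulmxA v) -map_mxM vE -scalemxAl mxE -dotmxE vv.
    by rewrite mulr1.
  have sp_ge0 : 0 <= sp 0 i by rewrite spE; exact: dnorm_ge0.
  have spR := RRe_real (ger0_real sp_ge0).
  exists (complex.Re (sp 0 i)).
    by rewrite -ltcR spR lt_def spi.
  rewrite -(eigenvalue_map (real_complex R)) /= spR.
  apply/eigenvalueP; exists v => //; apply: contra_eq_neq vv => ->.
  by rewrite dotmxE mul0mx mxE eq_sym oner_eq0.
pose s := [seq x <- rootsR (char_poly S) | 0 < x].
have sE x : (x \in s) = (0 < x) && eigenvalue S x.
  rewrite mem_filter eigenvalue_root_char.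
  by rewrite -(roots_on_rootsR (monic_neq0 (char_poly_monic S))).
have: sorted <=%O (sort <=%O s) by exact/sort_sorted/le_total.
have: l \in sort <=%O s by rewrite mem_sort sE l0.
case E: (sort _ s) => [//|x r] _ /= xr.
have mE y : (y \in x :: r) = (0 < y) && eigenvalue S y by rewrite -E mem_sort.
have /andP[x0 xE] : (0 < x) && eigenvalue S x by rewrite -mE mem_head.
exists x; split=> // y yE y0.
have: y \in x :: r by rewrite mE y0.
by rewrite inE => /predU1P[->//|]; apply/allP/(order_path_min le_trans).
Qed.

Lemma delta1_neq0 (R : realType) (d : Order.disp_t) (V : orderType d)
    (T : {fset {fset V}}) :
  T != fset0 -> {in T, forall t, #|` t| = 3%N} -> delta1 R T != 0.
Proof.
case/fset0Pn=> t tT T3.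
have: size (sort <=%O (enum_fset t)) = 3%N by rewrite size_sort -(T3 t tT).
case E: (sort _ _) => [|a [|b [|c []]]] //= _.
have mt x : (x \in t) = (x \in [:: a; b; c]) by rewrite -E mem_sort.
have Uabc : uniq [:: a; b; c] by rewrite -E sort_uniq fset_uniq.
have ab : a != b by move: Uabc; rewrite /= inE negb_or => /andP[/andP[]].
have tin x : x \in t -> x \in support_vertices T.
  by move=> xt; apply/bigfcupP; exists t => //; rewrite tT.
have ta : a \in t by rewrite mt !inE eqxx.
have tb : b \in t by rewrite mt !inE eqxx orbT.
have eE : [fset a; b] \in support_edges T.
  apply/imfset2P; exists a; rewrite /= ?tin //; exists b => //.
  rewrite inE /= tin //= /support_adj ab /=.
  by apply/hasP; exists t => //; rewrite ta tb.
apply/eqP => /matrixP /(_ (enum_rank [` tT]) (enum_rank [` eE])).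
rewrite !mxE !enum_rankK /= /incidence_sign E eqxx /=.
by move/eqP; rewrite oner_eq0.
Qed.

Lemma lambdaP (R : realType) (d : Order.disp_t) (V : orderType d)
    (T : {fset {fset V}}) :
  T != fset0 -> {in T, forall t, #|` t| = 3%N} ->
  is_smallest_pos_eigenvalue ((delta1 R T)^T *m delta1 R T) (lambda R T).
Proof.
move=> T0 T3; apply: xgetPex.
by apply: ex_smallest_pos_eigenvalue; exact: delta1_neq0.
Qed.

(* Main.v *)
Require Import Defs.
From mathcomp Require Import all_boot all_order all_algebra finmap.
From mathcomp Require Import complex.
From mathcomp Require Import reals.
From mathcomp Require Import zify ring lra.

(** Let [M] be the Gram matrix of [delta1]. Since its nonzero eigenvalues are at
    least [lambda], the diagonal entries satisfy [lambda * M e e <= (M^2) e e].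
    If [e] lies in [c] triples then [M e e = c] and [(M^2) e e = c^2 + 2 c],
    because two distinct edges share at most one triple; hence
    [lambda <= c + 2]. So if [lambda > n - 1] every edge lies in at least
    [n - 2] triples, every vertex has at least [n - 1] neighbours, and counting
    flags gives [n (n - 1) (n - 2) <= 6 |T|], with equality only if there are
    exactly [n] vertices, when [T] must be complete. In that case
    [M + d0 *m d0^T = n], where [d0] is the vertex-edge coboundary, and
    [delta1 *m d0 = 0], whence [M^2 = n M] and [lambda = n]. *)

Set Implicit Arguments.
Unset Strict Implicit.
Unset Printing Implicit Defensive.

Import Order.TTheory GRing.Theory Num.Theory.

Local Open Scope ring_scope.
Local Open Scope fset_scope.

(** * Spectral bound on the diagonal of a Gram matrix *)

(** Every eigenvalue [mu] of [S] is [0] or at least [l], so [mu * (mu - l) >= 0] and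
    [S *m S - l *: S] is positive semidefinite. The diagonalization is carried out over [R[i]],
    where the spectral theorem for normal matrices applies. *)
Lemma smallest_pos_eigenvalue_diag (R : realType) (p m : nat)
    (A : 'M[R]_(p, m)) (l : R) (i : 'I_m) :
  is_smallest_pos_eigenvalue (A^T *m A) l ->
  l * (A^T *m A) i i <= ((A^T *m A) *m (A^T *m A)) i i.
Proof.
set S := A^T *m A => -[_ l0 lmin].
pose toC q r := map_mx (real_complex R) : 'M_(q, r) -> 'M_(q, r).
have conjR q r (B : 'M[R]_(q, r)) : map_mx Num.conj (toC q r B) = toC q r B.
  by apply/matrixP=> j k; rewrite !mxE; exact: conjc_real.
have ST : S^T = S by rewrite /S trmx_mul trmxK.
have /orthomx_spectralP : toC m m S \is normalmx.
  by apply/normalmxP; rewrite -map_trmx conjR map_trmx ST.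
set P := spectralmx _; set sp := spectral_diag _ => SE.
have PU : P \in unitmx by exact: spectral_unit.
(* Row [j] of [P] is a unit eigenvector [v], and [sp 0 j] is the squared norm of [v A^T]. It is
   therefore real and nonnegative, and its real part is an eigenvalue of [S] over [R]. *)
have sp_ge j : (sp 0 j = 0) \/ (real_complex R l <= sp 0 j).
  pose v := row j P; have vE : v *m toC m m S = sp 0 j *: v.
    rewrite SE !mulmxA -!row_mul mulmxV // mul1mx row_mul row_diag_mx.
    by rewrite -scalemxAl -rowE.
  have vv : dotmx v v = 1.
    by have /row_unitarymxP/(_ j j) := spectral_unitarymx (toC m m S); rewrite eqxx.
  have spE : sp 0 j = dotmx (v *m toC m p A^T) (v *m toC m p A^T).
    rewrite dotmxE trmx_mul map_mxM map_trmx trmxK conjR.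
    rewrite mulmxA -(mulmxA v) -map_mxM vE -scalemxAl mxE -dotmxE vv.
    by rewrite mulr1.
  have sp_ge0 : 0 <= sp 0 j by rewrite spE; exact: dnorm_ge0.
  have spR := RRe_real (ger0_real sp_ge0).
  have [->|sp0] := eqVneq (sp 0 j) 0; first by left.
  right; rewrite -spR lecR; apply: lmin; last by rewrite -ltcR spR lt_def sp0.
  rewrite -(eigenvalue_map (real_complex R)) /= spR.
  apply/eigenvalueP; exists v => //; apply: contra_eq_neq vv => ->.
  by rewrite dotmxE mul0mx mxE eq_sym oner_eq0.
pose D := diag_mx sp; have PV := invmx_unitary (spectral_unitarymx (toC m m S)).
have SSE : toC m m (S *m S - l *: S) =
    invmx P *m (D *m D - real_complex R l *: D) *m P.
  rewrite /toC map_mxB map_mxZ map_mxM -/(toC m m S) SE -/D.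
  rewrite mulmxBr mulmxBl -!scalemxAr -!scalemxAl; congr (_ - _).
  by rewrite !mulmxA mulmxK.
rewrite -subr_ge0 -lecR.
have -> : ((S *m S) i i - l * S i i)%:C%C = toC m m (S *m S - l *: S) i i.
  by rewrite [in RHS]mxE; congr (_%:C)%C; rewrite !mxE.
have DE : D *m D - real_complex R l *: D =
    diag_mx (\row_j (sp 0 j * (sp 0 j - real_complex R l))).
  rewrite mulmx_diag; apply/matrixP=> j k; rewrite !mxE.
  by case: eqVneq => [->|]; rewrite ?mulr1n ?mulr0n ?mulr0 ?subr0 //; ring.
(* As [P] is unitary, the diagonal entry is the sum over [j] of [mu_j * (mu_j - l)] times the
   squared modulus of [P j i]. *)
rewrite SSE DE PV mul_mx_diag mxE; apply: sumr_ge0 => j _.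
rewrite !mxE mulrAC mulr_ge0 //.
  by rewrite -/P mulrC mul_conjC_ge0.
case: (sp_ge j) => [->|spj]; first by rewrite mul0r.
rewrite mulr_ge0 ?subr_ge0 //; apply: le_trans spj.
by rewrite lecR ltW.
Qed.

(** * Counting triples through pairs of vertices *)

Lemma card_fset_filter (K : choiceType) (A : {fset K}) (P : pred K) :
  #|` [fset x in A | P x]| = (\sum_(x <- A) P x)%N.
Proof.
rewrite card_fset_sum1 big_fset /= big_mkcond /=.
by apply: eq_bigr => x _; case: (P x).
Qed.

Section FsetCounting.
Variable V : choiceType.
Implicit Types (t W : {fset V}) (T : {fset {fset V}}).

Definition codegree T (x y : V) : nat :=
  \sum_(t <- T) ((x \in t) && (y \in t)).

Lemma fset3_from2 t x y : #|` t| = 3%N -> x != y -> x \in t -> y \in t ->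
  exists2 z, z \in t `\ x `\ y & t = [fset x; y; z].
Proof.
move=> t3 xy xt yt.
have : #|` t `\ x `\ y| == 1%N.
  move: t3; rewrite (cardfsD1 x) xt (cardfsD1 y) !inE eq_sym xy yt /=; lia.
move/cardfs1P=> [z E]; exists z; first by rewrite E inE.
apply/fsetP=> w; have := congr1 (fun A : {fset V} => w \in A) E; rewrite !inE.
case: (eqVneq w x) => [->|_]; first by rewrite xt.
by case: (eqVneq w y) => [->|_] //=; rewrite yt.
Qed.

(** The triples through [x] and [y] lie in the image of [z |-> [fset x; y; z]], with [z] in [W]
    minus [x] and [y]. The set [W] is left free: it will be either the whole vertex set or a closed
    neighbourhood. *)
Lemma codegree_le T W x y : {in T, forall t, #|` t| = 3%N} ->
  x != y -> x \in W -> y \in W ->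
  {in T, forall t, x \in t -> y \in t -> t `<=` W} ->
  (codegree T x y + 2 <= #|` W|)%N.
Proof.
move=> T3 xy xW yW TW.
have -> : codegree T x y = #|` [fset t in T | (x \in t) && (y \in t)]|.
  by rewrite card_fset_filter.
rewrite (cardfsD1 x W) xW (cardfsD1 y (W `\ x)) !inE eq_sym xy yW /=.
rewrite addnC addnA leq_add2l.
apply: leq_trans (leq_imfset_card imfset_key (fun z => [fset x; y; z])
  (mem (W `\ x `\ y))).
apply: fsubset_leq_card; apply/fsubsetP=> t.
rewrite !inE /= => /andP[tT /andP[xt yt]].
have [z zt tE] := fset3_from2 (T3 t tT) xy xt yt.
apply/imfsetP; exists z => //=.
move: zt; rewrite !inE => /and3P[-> -> /=].
by apply/fsubsetP/TW.
Qed.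

(** Double counting: each triple contains [3 * 2] ordered pairs of distinct vertices. *)
Lemma sum_codegree T W : {in T, forall t, #|` t| = 3%N} ->
  {in T, forall t, t `<=` W} ->
  (\sum_(x <- W) \sum_(y <- W `\ x) codegree T x y = 6 * #|` T|)%N.
Proof.
move=> T3 TW; rewrite card_fset_sum1 big_distrr /=.
under eq_bigr => x _ do rewrite exchange_big /=.
rewrite exchange_big /=; apply: eq_big_seq => t tT.
have sumW (A : {fset V}) : (\sum_(x <- A) (x \in t))%N = #|` A `&` t|.
  by rewrite -card_fset_filter; congr #|` _|; apply/fsetP=> x; rewrite !inE.
have step x : x \in W ->
  (\sum_(y <- W `\ x) ((x \in t) && (y \in t)) = (x \in t) * 2)%N.
  move=> xW; case xt: (x \in t) => /=; last by rewrite big1.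
  rewrite sumW mul1n fsetIDAC (fsetIidPr (TW t tT)).
  by have := T3 t tT; rewrite (cardfsD1 x) xt => -[].
rewrite (eq_big_seq _ step) -big_distrl /= sumW (fsetIidPr (TW t tT)).
by rewrite (T3 t tT).
Qed.

Lemma mem_support_vertices T t x : t \in T -> x \in t ->
  x \in support_vertices T.
Proof. by move=> tT xt; apply/bigfcupP; exists t => //; rewrite tT. Qed.

Lemma sub_support_vertices T t : t \in T -> t `<=` support_vertices T.
Proof. by move=> tT; apply/fsubsetP=> x; apply: mem_support_vertices. Qed.

Lemma support_adjP T x y :
  reflect (x != y /\ exists2 t, t \in T & (x \in t) && (y \in t))
    (support_adj T x y).
Proof. by apply: (iffP andP) => -[xy /hasP]. Qed.

Lemma support_adj_vertices T x y : support_adj T x y ->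
  (x \in support_vertices T) && (y \in support_vertices T).
Proof.
by move=> /support_adjP[_ [t tT /andP[xt yt]]]; rewrite !(mem_support_vertices tT).
Qed.

Lemma support_adj_ex T x : {in T, forall t, #|` t| = 3%N} ->
  x \in support_vertices T -> exists y, support_adj T x y.
Proof.
move=> T3 /bigfcupP[t /andP[tT _] xt].
have : (0 < #|` t `\ x|)%N by have := T3 t tT; rewrite (cardfsD1 x) xt add1n => -[->].
rewrite cardfs_gt0 => /fset0Pn[y]; rewrite !inE => /andP[yx yt].
by exists y; apply/support_adjP; rewrite eq_sym yx; split=> //; exists t; rewrite ?xt.
Qed.

Lemma large_codegree_count T n : {in T, forall t, #|` t| = 3%N} -> T != fset0 ->
  (forall x y, support_adj T x y -> (n <= codegree T x y + 2)%N) ->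
  (n <= #|` support_vertices T|)%N /\
  (#|` support_vertices T| * (n.-1 * n.-2) <= 6 * #|` T|)%N.
Proof.
move=> T3 T0 dT; set W := support_vertices T.
pose N x := [fset y in W | support_adj T x y].
have NW x : N x `<=` W `\ x.
  apply/fsubsetP=> y; rewrite !inE /= => /andP[-> /andP[xy _]].
  by rewrite eq_sym xy.
have card_N x : x \in W -> (n.-1 <= #|` N x|)%N.
  move=> xW; have [y xy] := support_adj_ex T3 xW.
  have := dT x y xy; have /andP[_ yW] := support_adj_vertices xy.
  have xNy : x != y by case/andP: xy.
  have xN : x \notin N x by rewrite !inE /= /support_adj eqxx andbF.
  (* All triples through [x] lie in its closed neighbourhood, so the codegree of one edge [xy]
     bounds the degree of [x] from below. *)
  have := @codegree_le T (x |` N x) x y T3 xNy.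
  rewrite cardfsU1 xN !inE /= eqxx yW xy orbT => /(_ isT isT) H.
  suff /H : {in T, forall t, x \in t -> y \in t -> t `<=` x |` N x} by lia.
  move=> t tT xt yt; apply/fsubsetP=> z zt; rewrite !inE /=.
  have [//|zx] /= := eqVneq z x; rewrite (mem_support_vertices tT zt) /=.
  by apply/support_adjP; rewrite eq_sym; split=> //; exists t; rewrite ?xt.
split.
  have /fset0Pn[t tT] := T0.
  have /fset0Pn[x xt] : t != fset0 by rewrite -cardfs_gt0 T3.
  have xW := mem_support_vertices tT xt.
  have := card_N x xW; have := fsubset_leq_card (NW x).
  by rewrite (cardfsD1 x W) xW; lia.
rewrite -(@sum_codegree T W) //; last by move=> t; apply: sub_support_vertices.
rewrite card_fset_sum1 big_distrl /= big_seq [X in (_ <= X)%N]big_seq.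
apply: leq_sum => x xW; rewrite mul1n.
(* Only the neighbours of [x] are kept: at least [n.-1] of them, each with codegree at least
   [n.-2]. *)
rewrite (big_fsetID _ (mem (N x))) /=.
apply: leq_trans (leq_addr _ _).
have -> : [fset y in W `\ x | y \in N x] = N x.
  apply/fsetP=> y; rewrite !inE /=.
  case: (boolP (support_adj T x y)) => [/andP[xy _]|]; rewrite ?andbF //.
  by rewrite eq_sym xy; case: (y \in W).
apply: leq_trans (_ : \sum_(y <- N x) n.-2 <= _)%N.
  by rewrite big_const_seq count_predT iter_addn_0 mulnC leq_mul2l card_N ?orbT.
rewrite big_seq [X in (_ <= X)%N]big_seq; apply: leq_sum => y.
by rewrite !inE /= => /andP[_ /dT]; lia.
Qed.

Lemma bin3E n : (6 * 'C(n, 3) = n * (n.-1 * n.-2))%N.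
Proof.
have := bin_ffact n 3; rewrite !ffactnS ffactn0 (_ : 3`!%N = 6)//.
by rewrite muln1; lia.
Qed.

(** [T] is contained in the family [B] of all triples of vertices. The flag count applied to [B],
    where codegrees are at most [n.-2], shows that [B] is no larger than [T]. *)
Lemma full_of_card T n : {in T, forall t, #|` t| = 3%N} ->
  #|` support_vertices T| = n -> #|` T| = 'C(n, 3) ->
  T = [fset t in fpowerset (support_vertices T) | #|` t| == 3%N].
Proof.
move=> T3; set W := support_vertices T; set B := [fset t in _ | _] => Wn Tn.
have B3 : {in B, forall t, #|` t| = 3%N} by move=> t; rewrite !inE => /andP[_ /eqP].
have BW : {in B, forall t, t `<=` W} by move=> t; rewrite !inE fpowersetE => /andP[].
apply/eqP; rewrite eqEfcard; apply/andP; split.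
  apply/fsubsetP=> t tT; rewrite !inE /= fpowersetE T3 // eqxx andbT.
  exact: sub_support_vertices.
suff : (6 * #|` B| <= n * (n.-1 * n.-2))%N.
  by rewrite Tn -bin3E leq_pmul2l.
rewrite -(sum_codegree B3 BW).
apply: leq_trans (_ : \sum_(x <- W) n.-1 * n.-2 <= _)%N; last first.
  by rewrite big_const_seq count_predT iter_addn_0 mulnC Wn.
rewrite big_seq [X in (_ <= X)%N]big_seq; apply: leq_sum => x xW.
apply: leq_trans (_ : \sum_(y <- W `\ x) n.-2 <= _)%N; last first.
  rewrite big_const_seq count_predT iter_addn_0 mulnC.
  by rewrite -Wn (cardfsD1 x W) xW.
rewrite big_seq [X in (_ <= X)%N]big_seq; apply: leq_sum => y.
rewrite !inE => /andP[yx yW].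
have := @codegree_le B W x y B3; rewrite eq_sym yx => /(_ isT xW yW) H.
by have := H (fun t tB _ _ => BW t tB); lia.
Qed.

End FsetCounting.

(** * Signs of edges in triples and of vertices in edges *)

Lemma sum_fset_single (R : nmodType) (K : choiceType) (A : {fset K}) (a : K)
    (F : K -> R) :
  (forall x, x \in A -> x != a -> F x = 0) ->
  \sum_(x <- A) F x = if a \in A then F a else 0.
Proof.
move=> F0; case: ifP => aA; last first.
  rewrite big_seq big1 // => x xA; apply: F0 => //.
  by apply: contraFN aA => /eqP <-.
rewrite (big_fsetD1 a) //= big_seq big1 ?addr0 // => x.
by rewrite !inE => /andP[xa xA]; apply: F0.
Qed.

Lemma fset2_from1 (K : choiceType) (e : {fset K}) (p : K) :
  #|` e| = 2%N -> p \in e -> exists2 q, p != q & e = [fset p; q].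
Proof.
move=> e2 pe.
have /cardfs1P[q E] : #|` e `\ p| == 1%N.
  by move: e2; rewrite (cardfsD1 p) pe add1n => -[->].
exists q.
  by have : q \in e `\ p; [rewrite E inE | rewrite !inE eq_sym => /andP[]].
by rewrite -(fsetD1K pe) E.
Qed.

Section Incidence.
Variables (d : Order.disp_t) (V : orderType d).
Implicit Types (t e : {fset V}) (T : {fset {fset V}}).

Lemma eq_fset2 (a b c e : V) : (a < b)%O -> (c < e)%O ->
  ([fset a; b] == [fset c; e]) = (a == c) && (b == e).
Proof.
move=> ab ce; apply/eqP/andP => [E|[/eqP-> /eqP->]//].
have mE x : (x \in [fset a; b]) = (x \in [fset c; e]) by rewrite E.
have := mE a; have := mE b; have := mE c.
rewrite !inE !eqxx !orbT /= => /orP[/eqP ca|/eqP cb].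
  subst c; rewrite (gt_eqF ab) /= => /esym/eqP-> _; by rewrite !eqxx.
subst c; move=> _ /esym; rewrite (lt_eqF ab) /= => /eqP ae.
by move: (lt_trans ab ce); rewrite ae ltxx.
Qed.

(** The nested tests of [incidence_sign] become a linear combination of indicators, possible because
    the three pairs are distinct; sums over edges then split. *)
Definition oriented_triple t (a b c : V) : Prop :=
  [/\ (a < b)%O, (b < c)%O, t = [fset a; b; c] &
   forall e, incidence_sign t e =
     (e == [fset a; b])%:R + (e == [fset b; c])%:R - (e == [fset a; c])%:R].

Lemma oriented_tripleP t : #|` t| = 3%N -> exists a b c, oriented_triple t a b c.
Proof.
move=> t3.
have: size (sort <=%O (enum_fset t)) = 3%N by rewrite size_sort -t3.
have: sorted <%O (sort <=%O (enum_fset t)).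
  by rewrite sort_lt_sorted fset_uniq.
case E: (sort _ _) => [|a [|b [|c []]]] //= /and3P[ab bc _] _.
have ac := lt_trans ab bc.
exists a, b, c; split=> //.
  apply/fsetP=> x; have := mem_sort <=%O (enum_fset t) x.
  by rewrite E !inE orbA => <-.
move=> e; rewrite /incidence_sign E.
case: eqVneq => [->|_]; first
  by rewrite !eq_fset2 // !eqxx (lt_eqF ab) (lt_eqF bc).
case: eqVneq => [->|_] /=; first by rewrite !eq_fset2 // !eqxx (gt_eqF ab).
by case: eqVneq.
Qed.

Lemma support_edgesP T e : reflect
  (exists x y, support_adj T x y /\ e = [fset x; y]) (e \in support_edges T).
Proof.
apply: (iffP idP) => [/imfset2P[x xW [y]]|[x [y [xy ->]]]].
  by rewrite inE /= => /andP[yW xy] ->; exists x, y.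
have /andP[xW yW] := support_adj_vertices xy.
by apply/imfset2P; exists x => //; exists y => //; rewrite inE /= yW.
Qed.

Lemma support_edges_card T e : e \in support_edges T -> #|` e| = 2%N.
Proof. by case/support_edgesP=> x [y [/andP[xy _] ->]]; rewrite cardfs2 xy. Qed.

Lemma support_edges_sub T e : e \in support_edges T -> e `<=` support_vertices T.
Proof.
case/support_edgesP=> x [y [/support_adj_vertices/andP[xW yW] ->]].
by apply/fsubsetP=> z; rewrite !inE => /orP[]/eqP->.
Qed.

Lemma support_edge_of T t x y : t \in T -> x \in t -> y \in t -> x != y ->
  [fset x; y] \in support_edges T.
Proof.
move=> tT xt yt xy; apply/support_edgesP; exists x, y; split=> //.
by apply/support_adjP; split=> //; exists t; rewrite ?xt.
Qed.

Lemma fset2_lt e : #|` e| = 2%N -> exists a b, (a < b)%O /\ e = [fset a; b].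
Proof.
move=> e2; have /fset0Pn[p pe] : e != fset0 by rewrite -cardfs_gt0 e2.
have [q pq ->] := fset2_from1 e2 pe.
case: (ltgtP p q) pq => [pq _|qp _|//].
  by exists p, q.
by exists q, p; rewrite fsetUC.
Qed.

Variable R : realType.
Local Notation sg t e := ((incidence_sign t e)%:~R : R).

(** This is the coboundary of the edge function [F] at [t]: all three pairs of [t] are support
    edges, and each indicator selects one of them. *)
Lemma sum_incidence T t a b c (F : {fset V} -> R) :
  t \in T -> oriented_triple t a b c ->
  \sum_(e <- support_edges T) sg t e * F e =
    F [fset a; b] + F [fset b; c] - F [fset a; c].
Proof.
move=> tT [ab bc tE sE].
have ac := lt_trans ab bc.
have [at_ bt ct] : [/\ a \in t, b \in t & c \in t].
  by rewrite tE !inE !eqxx ?orbT.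
have single x : x \in support_edges T ->
    \sum_(e <- support_edges T) (e == x)%:R * F e = F x.
  move=> xE; rewrite (@sum_fset_single _ _ _ x) ?xE ?eqxx ?mul1r //.
  by move=> e _ /negPf->; rewrite mul0r.
under eq_bigr => e _ do rewrite sE rmorphB rmorphD /= !rmorph_nat mulrBl mulrDl.
rewrite sumrB big_split /= !single //;
  by apply: (support_edge_of tT) => //; rewrite lt_eqF.
Qed.

(** Squaring forgets the orientation and turns signs into inclusions, which can be counted. *)
Lemma incidence_sign_sqr t e : #|` t| = 3%N -> #|` e| = 2%N ->
  sg t e ^+ 2 = (e `<=` t)%:R.
Proof.
move=> /oriented_tripleP[a [b [c [ab bc tE sE]]]] /fset2_lt[u [v [uv ->]]].
have ac := lt_trans ab bc.
have -> : ([fset u; v] `<=` t) = [|| [fset u; v] == [fset a; b],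
    [fset u; v] == [fset b; c] | [fset u; v] == [fset a; c]].
  rewrite fsubUset !fsub1set tE; apply/idP/idP; last first.
    by case/or3P=> /eqP E; have := fset21 u v; have := fset22 u v;
      rewrite E !inE => /orP[]/eqP-> /orP[]/eqP->; rewrite !eqxx ?orbT.
  rewrite !inE -!orbA => /andP[/or3P Hu /or3P Hv].
  case: Hu uv => /eqP->; case: Hv => /eqP-> uv; rewrite ?eqxx ?orbT //;
    by move: uv; rewrite ltNge ?lexx ?(ltW ab) ?(ltW bc) ?(ltW ac).
rewrite sE !eq_fset2 // rmorphB rmorphD /= !rmorph_nat.
have [->|_] := eqVneq u a.
  rewrite (lt_eqF ab) /=.
  have [->|_] := eqVneq v b; first by rewrite (lt_eqF bc) /=; ring.
  by case: (v == c); rewrite /=; ring.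
by rewrite /=; case: (_ && _); rewrite /= ?orbF; ring.
Qed.


Lemma sum_incidence_sqr T t : t \in T -> #|` t| = 3%N ->
  \sum_(e <- support_edges T) sg t e ^+ 2 = 3.
Proof.
move=> tT /oriented_tripleP[a [b [c H]]].
under eq_bigr do rewrite expr2.
rewrite (sum_incidence _ tT H); case: H => ab bc _ sE.
have ac := lt_trans ab bc.
rewrite !sE !eq_fset2 // !rmorphB !rmorphD /= !rmorph_nat.
rewrite !eqxx (lt_eqF ab) (gt_eqF ab) (lt_eqF bc) (gt_eqF bc).
by rewrite !andbF /=; lra.
Qed.

(** The union of two distinct edges has at least three vertices, so a triple containing both must
    equal it. *)
Lemma incidence_pair_eq0 t e e' : #|` t| = 3%N -> #|` e| = 2%N ->
  #|` e'| = 2%N -> e != e' -> t != e `|` e' -> sg t e * sg t e' = 0.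
Proof.
move=> t3 e2 e'2 ee' tU; apply/eqP; rewrite -sqrf_eq0 exprMn.
rewrite !incidence_sign_sqr // -natrM pnatr_eq0 mulnb -fsubUset eqb0.
apply: contra tU => sub; rewrite eq_sym eqEfcard sub t3 /=.
rewrite ltnNge; apply: contra ee' => U2.
have eU : e = e `|` e' by apply/eqP; rewrite eqEfcard fsubsetUl e2.
have e'U : e' = e `|` e' by apply/eqP; rewrite eqEfcard fsubsetUr e'2.
by rewrite eU -e'U.
Qed.

(** Entry of the vertex-edge coboundary [d0]: [1] at the larger end of an edge, [-1] at the smaller.
    Testing whether [v] is the maximum avoids naming the two ends. *)
Definition vertex_sign e (v : V) : R :=
  if v \in e then if all (fun x => x <= v)%O e then 1 else -1 else 0.

Lemma vertex_signE a b v : (a < b)%O ->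
  vertex_sign [fset a; b] v = (v == b)%:R - (v == a)%:R.
Proof.
move=> ab; rewrite /vertex_sign !inE.
have allE : all (fun x => x <= v)%O [fset a; b] = (b <= v)%O.
  apply/allP/idP => [/(_ b)|bv x]; first by rewrite !inE eqxx orbT; apply.
  by rewrite !inE => /orP[]/eqP-> //; apply: le_trans bv; rewrite ltW.
rewrite allE; have [->|va] /= := eqVneq v a.
  by rewrite leNgt ab (lt_eqF ab) /=; lra.
by have [->|//] := eqVneq v b; rewrite ?lexx subr0.
Qed.

Lemma vertex_sign_sqr e v : vertex_sign e v ^+ 2 = (v \in e)%:R.
Proof.
rewrite /vertex_sign; case: ifP => _; last by rewrite expr0n.
by case: ifP => _; rewrite ?sqrrN expr1n.
Qed.

(** The relation [delta1 *m d0 = 0] at the entry [(t, v)]: the coboundary of a coboundary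
    vanishes. *)
Lemma sum_incidence_vertex T t v : t \in T -> #|` t| = 3%N ->
  \sum_(e <- support_edges T) sg t e * vertex_sign e v = 0.
Proof.
move=> tT /oriented_tripleP[a [b [c H]]].
rewrite (sum_incidence _ tT H); case: H => ab bc _ sE.
by rewrite !vertex_signE //; [ring|apply: lt_trans bc].
Qed.

(** Only two edges of [t] contain [p], so the relation [delta1 *m d0 = 0] at [(t, p)] has just two
    terms, which must cancel. *)
Lemma incidence_vertex_pair t p q r : t = [fset p; q; r] -> #|` t| = 3%N ->
  p != q -> p != r -> q != r ->
  sg t [fset p; q] * sg t [fset p; r] =
  - (vertex_sign [fset p; q] p * vertex_sign [fset p; r] p).
Proof.
move=> tE t3 pq pr qr.
have tT : t \in [fset t] by rewrite inE.
have [pt qt rt] : [/\ p \in t, q \in t & r \in t] by rewrite tE !inE !eqxx ?orbT.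
have := sum_incidence_vertex p tT t3.
have eNe' : [fset p; q] != [fset p; r].
  apply/eqP=> /fsetP/(_ q); rewrite !inE eqxx orbT (negPf qr).
  by rewrite eq_sym (negPf pq).
rewrite (big_fsetD1 [fset p; q]) ?(support_edge_of tT) //=.
rewrite (big_fsetD1 [fset p; r]) /=; last first.
  by rewrite !inE eq_sym eNe' (support_edge_of tT).
rewrite big_seq big1 => [|e]; last first.
  rewrite !inE => /and3P[eNr eNq eE].
  have e2 := support_edges_card eE.
  apply/eqP; rewrite -sqrf_eq0 exprMn incidence_sign_sqr // vertex_sign_sqr.
  rewrite -natrM pnatr_eq0 mulnb eqb0; apply: contra eNr => /andP[et pe].
  have [s ps eE'] := fset2_from1 e2 pe.
  have : s \in t by apply: (fsubsetP et); rewrite eE' !inE eqxx orbT.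
  rewrite tE !inE eq_sym (negPf ps) /= => /orP[]/eqP sE; last by rewrite eE' sE.
  by rewrite eE' sE eqxx in eNq.
rewrite addr0 => H.
have := incidence_sign_sqr t3 (_ : #|` [fset p; r]| = 2%N).
have := vertex_sign_sqr [fset p; q] p.
rewrite cardfs2 pr fsubUset !fsub1set pt rt !inE eqxx /= => v1 /(_ erefl) s1.
set s := sg t [fset p; q] in H *; set s' := sg t [fset p; r] in H s1 *.
set v := vertex_sign [fset p; q] p in H v1 *; set v' := vertex_sign _ p in H *.
(* The factor [s' * v] is chosen so that, [v] and [s'] having square [1], the relation becomes
   [s * s' + v * v' = 0]. *)
have : (s' * v * (s * v + s' * v') = 0)%R by rewrite H mulr0.
have -> : (s' * v * (s * v + s' * v') = s * s' * v ^+ 2 + s' ^+ 2 * (v * v'))%R.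
  by ring.
by rewrite v1 s1; lra.
Qed.

End Incidence.

(** * The Gram matrix and the bound on [lambda] *)

Section Spectrum.
Local Open Scope ring_scope.
Variables (R : realType) (d : Order.disp_t) (V : orderType d).
Variable T : {fset {fset V}}.
Hypothesis T3 : {in T, forall t, #|` t| = 3%N}.
Local Notation sg t e := ((incidence_sign t e)%:~R : R).
Local Notation E := (support_edges T).
Local Notation W := (support_vertices T).
Local Notation M := ((delta1 R T)^T *m delta1 R T).

Lemma sum_enum_fset (K : choiceType) (A : {fset K}) (F : K -> R) :
  \sum_(i < #|{: A}|) F (fsval (enum_val i)) = \sum_(x <- A) F x.
Proof. by rewrite big_seq_fsetE /= (big_enum_val (fun x : A => F (fsval x))). Qed.

Definition gram e e' : R := \sum_(t <- T) sg t e * sg t e'.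

Lemma gramE i j : M i j = gram (fsval (enum_val i)) (fsval (enum_val j)).
Proof.
rewrite mxE /gram -sum_enum_fset; apply: eq_bigr => k _.
by rewrite !mxE.
Qed.

Lemma gram_diag x y : support_adj T x y ->
  gram [fset x; y] [fset x; y] = (codegree T x y)%:R.
Proof.
move=> /andP[xy _]; rewrite /gram /codegree natr_sum.
apply: eq_big_seq => t tT; rewrite -expr2 incidence_sign_sqr ?(T3 tT) ?cardfs2 ?xy //.
by rewrite fsubUset !fsub1set.
Qed.

Lemma gram_offdiag e e' : e \in E -> e' \in E -> e != e' ->
  gram e e' = if e `|` e' \in T then
                sg (e `|` e') e * sg (e `|` e') e' else 0.
Proof.
move=> eE e'E ee'; apply: sum_fset_single => t tT.
by apply: incidence_pair_eq0; rewrite ?(T3 tT)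
  ?(support_edges_card eE) ?(support_edges_card e'E).
Qed.

(** The sum defining [gram e e'] has at most one nonzero term, so squaring passes inside it. *)
Lemma gram_offdiag_sqr e e' : e \in E -> e' \in E -> e != e' ->
  gram e e' ^+ 2 = \sum_(t <- T) sg t e ^+ 2 * sg t e' ^+ 2.
Proof.
move=> eE e'E ee'; rewrite gram_offdiag // (@sum_fset_single _ _ _ (e `|` e')).
  by case: ifP; rewrite ?expr0n // exprMn.
move=> t tT tU; rewrite -exprMn.
by rewrite incidence_pair_eq0 ?expr0n // ?(T3 tT)
  ?(support_edges_card eE) ?(support_edges_card e'E).
Qed.

(* Each triple through [e] meets exactly two other edges, and two distinct edges
   lie in at most one common triple. *)
Lemma sum_gram_sqr e : e \in E ->
  \sum_(e' <- E) gram e e' ^+ 2 = gram e e ^+ 2 + 2 * gram e e.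
Proof.
move=> eE; rewrite (big_fsetD1 e) //=; congr (_ + _)%R.
transitivity (\sum_(e' <- E `\ e) \sum_(t <- T) sg t e ^+ 2 * sg t e' ^+ 2).
  apply: eq_big_seq => e'; rewrite !inE eq_sym => /andP[ee' e'E].
  exact: gram_offdiag_sqr.
rewrite exchange_big /gram mulr_sumr /=; apply: eq_big_seq => t tT.
have := sum_incidence_sqr R tT (T3 tT); rewrite (big_fsetD1 e) //= => H.
(* Multiplied by the indicator that [e] lies in [t], the right-hand side becomes twice that
   indicator. *)
have {}H : \sum_(e' <- E `\ e) sg t e' ^+ 2 = (3 - sg t e ^+ 2)%R by lra.
rewrite -mulr_sumr H incidence_sign_sqr ?(T3 tT) ?(support_edges_card eE) //.
rewrite -expr2 incidence_sign_sqr ?(T3 tT) ?(support_edges_card eE) //.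
by case: (_ `<=` _) => /=; ring.
Qed.

Lemma codegree_gt0 x y : support_adj T x y -> (0 < codegree T x y)%N.
Proof.
move=> /support_adjP[_ [t tT xyt]].
by rewrite /codegree (big_fsetD1 t) //= xyt.
Qed.

(** The spectral bound at the edge [xy] reads [lambda * c <= c ^ 2 + 2 * c]; the codegree [c] is
    positive and can be cancelled. *)
Lemma lambda_le_codegree x y : T != fset0 -> support_adj T x y ->
  (lambda R T <= (codegree T x y)%:R + 2)%R.
Proof.
move=> T0 xy; have eE : [fset x; y] \in E by apply/support_edgesP; exists x, y.
have := smallest_pos_eigenvalue_diag (enum_rank [` eE]) (lambdaP R T0 T3).
have -> : (M *m M) (enum_rank [` eE]) (enum_rank [` eE]) =
    \sum_(e' <- E) gram [fset x; y] e' ^+ 2.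
  rewrite mxE -sum_enum_fset; apply: eq_bigr => k _.
  rewrite !gramE enum_rankK /= expr2; congr (_ * _).
  by apply: eq_bigr => t _; rewrite mulrC.
rewrite gramE enum_rankK /= sum_gram_sqr // gram_diag //.
have : 0 < (codegree T x y)%:R :> R by rewrite ltr0n codegree_gt0.
set c := _%:R => c0; rewrite expr2 -mulrDl ler_pM2r //.
Qed.

(** * The family of all triples *)

Section Complete.
Variable n : nat.
Hypothesis T_full : T = [fset t in fpowerset W | #|` t| == 3%N].
Hypothesis codegreeE : forall x y, support_adj T x y -> (codegree T x y + 2)%N = n.

(** On the diagonal this is [c + 2 = n]. Disjoint edges lie in no common triple and share no vertex.
    Edges meeting in [p] span a triple of [T], and the two terms cancel by
    [incidence_vertex_pair]. *)
Lemma gram_vertex e e' : e \in E -> e' \in E ->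
  gram e e' + \sum_(v <- W) vertex_sign R e v * vertex_sign R e' v =
  (e == e')%:R * n%:R :> R.
Proof.
move=> eE e'E; have e2 := support_edges_card eE; have e'2 := support_edges_card e'E.
have [<-|ee'] := eqVneq e e'.
  case/support_edgesP: (eE) => x [y [xy exy]].
  rewrite {1 2}exy gram_diag // -(codegreeE xy) natrD mul1r; congr (_ + _)%R.
  under eq_bigr do rewrite -expr2 vertex_sign_sqr.
  rewrite -natr_sum -card_fset_filter; congr (_%:R); rewrite -e2.
  congr #|` _|; apply/fsetP=> v; rewrite !inE /= andb_idl //.
  exact/fsubsetP/support_edges_sub.
rewrite mul0r.
have [e0|/fset0Pn[p]] := eqVneq (e `&` e') fset0.
  rewrite gram_offdiag // ifF ?add0r; last first.
    apply/negP=> /T3; rewrite cardfsU e2 e'2 e0 cardfs0 //.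
  rewrite big1 // => v _; rewrite /vertex_sign.
  have [ve|_] := boolP (v \in e); last by rewrite mul0r.
  have [ve'|_] := boolP (v \in e'); last by rewrite mulr0.
  by have : v \in e `&` e'; [rewrite inE ve|rewrite e0].
rewrite inE => /andP[pe pe'].
have [q pq eq] := fset2_from1 e2 pe; have [r pr er] := fset2_from1 e'2 pe'.
have qr : q != r by apply: contraNneq ee' => qr; rewrite eq er qr.
have UE : e `|` e' = [fset p; q; r].
  by apply/fsetP=> z; rewrite eq er !inE; case: (z == p); case: (z == q).
have U3 : #|` e `|` e'| = 3%N.
  by rewrite UE fsetUC cardfsU1 cardfs2 !inE pq negb_or eq_sym pr eq_sym qr.
have UT : e `|` e' \in T.
  rewrite T_full !inE fpowersetE U3 eqxx andbT fsubUset.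
  by apply/andP; split; apply: support_edges_sub.
rewrite gram_offdiag // UT (@sum_fset_single _ _ _ p).
  rewrite (fsubsetP (support_edges_sub eE) p pe) /=.
  have := incidence_vertex_pair R UE U3 pq pr qr.
  by rewrite -eq -er => ->; rewrite addNr.
move=> v _ vp; rewrite /vertex_sign eq er !inE (negPf vp) /=.
case: ifP => [/eqP vq|_]; last by rewrite mul0r.
by rewrite vq (negPf qr) mulr0.
Qed.

Lemma complete_gram_sqr : M *m M = n%:R *: M.
Proof.
pose D0 : 'M[R]_(#|{: E}|, #|{: W}|) :=
  \matrix_(i, v) vertex_sign R (fsval (enum_val i)) (fsval (enum_val v)).
have dD : delta1 R T *m D0 = 0.
  apply/matrixP=> i v; rewrite !mxE.
  rewrite -[RHS](@sum_incidence_vertex _ _ R T (fsval (enum_val i))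
    (fsval (enum_val v))); [|exact: fsvalP|exact/T3/fsvalP].
  by rewrite -sum_enum_fset; apply: eq_bigr => k _; rewrite !mxE.
have ME : M = n%:R%:M - D0 *m D0^T.
  apply/eqP; rewrite eq_sym subr_eq; apply/eqP/matrixP=> i j.
  rewrite [RHS]mxE gramE [X in _ = (_ + X)%R]mxE.
  have -> : \sum_k D0 i k * D0^T k j = \sum_(v <- W)
      vertex_sign R (fsval (enum_val i)) v * vertex_sign R (fsval (enum_val j)) v.
    by rewrite -sum_enum_fset; apply: eq_bigr => k _; rewrite !mxE.
  rewrite gram_vertex ?fsvalP // !mxE.
  by rewrite (inj_eq val_inj) (inj_eq enum_val_inj) mulr_natl.
(* Only the right factor is expanded, so that [delta1] meets [D0] and the second term vanishes. *)
rewrite [X in _ *m X]ME mulmxBr mul_mx_scalar mulmxA -(mulmxA _ _ D0).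
by rewrite dD mulmx0 mul0mx subr0.
Qed.

(** On an eigenvector, [M *m M = n%:R *: M] gives [lambda ^ 2 = n * lambda], and [lambda] is
    positive. *)
Lemma complete_lambda : T != fset0 -> lambda R T = n%:R.
Proof.
move=> T0; have [/eigenvalueP[v vM v0] l0 _] := lambdaP R T0 T3.
have : v *m M *m M = n%:R *: (v *m M).
  by rewrite -mulmxA complete_gram_sqr -scalemxAr.
rewrite vM -scalemxAl vM !scalerA => /eqP; rewrite -subr_eq0 -scalerBl.
rewrite scaler_eq0 (negPf v0) orbF -mulrBl mulf_eq0 (gt_eqF l0) orbF subr_eq0.
by move/eqP.
Qed.

End Complete.
End Spectrum.

(** * Isomorphism with the complete graph, and the conclusion *)

Lemma complete_support_graph (d : Order.disp_t) (V : orderType d)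
    (T : {fset {fset V}}) (n : nat) : (3 <= n)%N ->
  #|` support_vertices T| = n ->
  T = [fset t in fpowerset (support_vertices T) | #|` t| == 3%N] ->
  graph_iso (support_graph T) (complete_graph n).
Proof.
set W := support_vertices T => n3 Wn TE.
have cW : #|{: W}| = n by rewrite -Wn cardfE.
exists (fun x => cast_ord cW (enum_rank x)).
  exists (fun i => enum_val (cast_ord (esym cW) i)) => x.
    by rewrite cast_ordK enum_rankK.
  by rewrite enum_valK cast_ordKV.
move=> x y; rewrite /complete_graph /support_graph.
rewrite (inj_eq (@cast_ord_inj _ _ _)) (inj_eq enum_rank_inj).
rewrite /support_adj (inj_eq val_inj); case: eqVneq => //= xy.
(* Since [n >= 3] a third vertex [z] exists, and the triple it forms with [x] and [y] makes them
   adjacent. *)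
have : (0 < #|` W `\ fsval x `\ fsval y|)%N.
  have := cardfsD1 (fsval x) W; have := cardfsD1 (fsval y) (W `\ fsval x).
  by rewrite !inE (inj_eq val_inj) eq_sym xy !fsvalP /= Wn; lia.
rewrite cardfs_gt0 => /fset0Pn[z]; rewrite !inE => /and3P[zy zx zW].
apply/esym/hasP; exists [fset fsval x; fsval y; z]; last by rewrite !inE !eqxx orbT.
rewrite TE !inE fpowersetE /=; apply/andP; split.
  by apply/fsubsetP=> w; rewrite !inE -orbA => /or3P[]/eqP-> //; apply: fsvalP.
by rewrite fsetUC cardfsU1 cardfs2 !inE negb_or zx zy (inj_eq val_inj) xy.
Qed.

Theorem theorem3p7 (R : realType) (d : Order.disp_t) (V : orderType d)
    (n : nat) (T : {fset {fset V}})
    (hn : (3 <= n)%N)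
    (T_neq0 : T != fset0)
    (T_card3 : forall t : {fset V}, t \in T -> #|` t| = 3%N) :
  ((#|` T| < 'C(n, 3))%N -> lambda R T <= n%:R - 1) /\
  (#|` T| = 'C(n, 3) -> n%:R - 1 < lambda R T ->
     [/\ lambda R T = n%:R,
         graph_iso (support_graph T) (complete_graph n)
       & T = [fset t in fpowerset (support_vertices T) | #|` t| == 3%N]]).
Proof.
have codeg : (n%:R - 1 < lambda R T)%R ->
    forall x y, support_adj T x y -> (n <= codegree T x y + 2)%N.
  move=> lt_l x y xy; have := lambda_le_codegree R T_card3 T_neq0 xy.
  (* Integrality turns the strict [n - 1 < c + 2] into [n <= c + 2]. *)
  move=> /(lt_le_trans lt_l); rewrite ltrBlDr -natrD -(natrD _ _ 1) ltr_nat; lia.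
split=> [ltT|cT lt_l].
  rewrite leNgt; apply/negP=> /codeg /(large_codegree_count T_card3 T_neq0)[nW].
  have := leq_mul2r (n.-1 * n.-2) n #|` support_vertices T|.
  by rewrite nW orbT -bin3E; lia.
have dT := codeg lt_l.
have [nW cW] := large_codegree_count T_card3 T_neq0 dT.
have Wn : #|` support_vertices T| = n.
  apply/eqP; rewrite eqn_leq nW andbT.
  (* The factor [n.-1 * n.-2] is positive as [n >= 3], so it cancels and leaves at most [n]
     vertices. *)
  move: cW; rewrite cT bin3E leq_pmul2r //; nia.
have T_full := full_of_card T_card3 Wn cT.
split=> //; last exact: complete_support_graph.
(* With exactly [n] vertices, the upper bound on codegrees meets the lower bound [dT]. *)
apply: complete_lambda => // x y xy; apply/eqP; rewrite eqn_leq dT // andbT -Wn.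
have /andP[xW yW] := support_adj_vertices xy.
apply: codegree_le => //; first by case/andP: xy.
by move=> t tT _ _; apply: sub_support_vertices.
Qed.
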